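(* Let $(X,d)$ be a metric space and let $f:X\to\mathbb{R}\cup\{+\infty\}$ be a proper extended real-valued function on $X$. Then there is a rich family $\mathcal{R}$ of closed separable sets in $X$ such that for every $Y\in\mathcal{R}$ and every $x\in Y$ we have $$|\nabla f|(x)=|\nabla(f|_Y)|(x).$$
   Context: Proper means that $f$ is not identically $+\infty$. A family $\mathcal{R}$ of closed separable subsets (subspaces) of $X$ is called rich if: (i) (cofinality) for every separable subspace $Y_0$ of $X$ there is $Y\in\mathcal{R}$ with $Y_0\subset Y$; (ii) ($\sigma$-closedness) if $(Y_i)_{i\ge1}$ is an increasing sequence of elements of $\mathcal{R}$, then $\overline{\bigcup_{i\ge1}Y_i}\in\mathcal{R}$. The slope of a function $f:X\to\mathbb{R}\cup\{+\infty\}$ at $x\in X$ is $$|\nabla f|(x):=\limsup_{x\neq u\to x}\frac{(f(x)-f(u))^+}{d(x,u)},$$ where $s^+=\max\{s,0\}$, with the convention $+\infty-\infty=0$; points $x\notin\mathrm{dom}\, f$ (i.e. $f(x)=+\infty$) are allowed. If $x$ is an isolated point, the limsup (over an empty set of $u$) is taken to be $0$. $f|_Y$ is the restriction of $f$ to $Y$, and $|\nabla(f|_Y)|(x)$ is given by the same formula with $u$ ranging over $Y$ only. *)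

(* Defs.v *)
From mathcomp Require Import all_boot all_order all_algebra.
From mathcomp Require Import all_classical all_reals all_analysis.

Set Implicit Arguments.
Unset Strict Implicit.
Unset Printing Implicit Defensive.

Import Order.TTheory GRing.Theory Num.Theory.
Import numFieldNormedType.Exports.

Local Open Scope classical_set_scope.
Local Open Scope ring_scope.

Definition separable_set (T : topologicalType) (Y : set T) : Prop :=
  exists D : set T, [/\ countable D, D `<=` Y & Y `<=` closure D].

Definition rich_family (T : topologicalType) (F : set (set T)) : Prop :=
  [/\ forall Y, F Y -> closed Y /\ separable_set Y,
      forall Y0, separable_set Y0 -> exists2 Y, F Y & Y0 `<=` Y
    & forall Y_ : nat -> set T,
        (forall i, F (Y_ i)) -> (forall i, Y_ i `<=` Y_ i.+1) ->
        F (closure (\bigcup_i Y_ i))].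

(* The library's [+oo - +oo] is [-oo] and not [0], but only its positive part
   occurs below, and that is [0] for both conventions. *)
Definition descent_quotient (R : realType) (X : metricType R)
    (f : X -> \bar R) (x u : X) : \bar R :=
  (maxe (f x - f u) 0 * ((mdist x u)^-1)%:E)%E.

(* The slope at [x] of the restriction of [f] to [Y], meaningful for [x] in [Y].
   At an isolated point of [Y] the filter is improper and [limf_esup] would be
   [-oo], the supremum of the empty set in [\bar R], hence the case split. *)
Definition slope_on (R : realType) (X : metricType R) (Y : set X)
    (f : X -> \bar R) (x : X) : \bar R :=
  if `[< isolated Y x >] then 0%E
  else limf_esup (descent_quotient f x) (within (Y `\ x) (nbhs x)).

Definition slope (R : realType) (X : metricType R) (f : X -> \bar R) (x : X) :
    \bar R :=
  slope_on setT f x.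

(* Main.v *)
Require Import Defs.
From mathcomp Require Import all_boot all_order all_algebra.
From mathcomp Require Import all_classical all_reals all_analysis.
From mathcomp Require Import lra.

Set Implicit Arguments.
Unset Strict Implicit.
Unset Printing Implicit Defensive.

Import Order.TTheory GRing.Theory Num.Theory.
Import numFieldNormedType.Exports.

Local Open Scope classical_set_scope.
Local Open Scope ring_scope.

(** The slope of [f] at [x] only depends on which pairs (distance to [x],
    value of [f]) occur near [x]: for real [t >= 0], the slope exceeds [t] iff
    for some [s > t] there are points [u <> x] arbitrarily close to [x] with
    [f u + s * mdist x u < f x] ([lt_slope_onP], [lt_descent_quotientP]).  As
    this inequality is strict, it survives when the value of [f u] and the
    distance are slightly increased.  So a set [Y] computes the same slopes as
    the whole space as soon as it is saturated: whenever an open annulus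
    centred at a point of [Y] meets a strict sublevel set [f < a], it does so
    inside [Y] ([annulus_saturated_slope]).  The family of all closed separable
    saturated sets is the required one.

    It is rich because saturation is robust in two ways.  An annulus around [x]
    contains slightly thinner annuli around all points close to [x], so
    saturation passes from a set to its closure, without any continuity of [f],
    and moreover it is enough to test annuli and levels with rational
    parameters ([annulus_saturated_closure]).  Hence closures of unions of
    saturated sets are saturated, and a countable set becomes saturated for
    rational parameters after adjoining countably many witnesses
    ([annulus_saturated_hull]), which gives cofinality. *)

Lemma ereal_dense_EFin (R : realType) (x y : \bar R) :
  (x < y)%E -> exists2 c : R, (x < c%:E)%E & (c%:E < y)%E.
Proof.
move: x y => [x||] [y||] //= xy.
- by exists ((x + y) / 2); rewrite lte_fin (midf_lt xy).
- by exists (x + 1); rewrite ?ltry// lte_fin ltrDl.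
- by exists (y - 1); rewrite ?ltNyr// lte_fin ltrBlDr ltrDl.
- by exists 0; rewrite ?ltry ?ltNyr.
Qed.

(** Reduces an equality of slopes to the comparison of the nonnegative real
    numbers below them, so that infinite slopes need no separate treatment. *)
Lemma le_of_lt_nneg_EFin (R : realType) (x y : \bar R) : (0 <= y)%E ->
  (forall t : R, 0 <= t -> (t%:E < x)%E -> (t%:E < y)%E) -> (x <= y)%E.
Proof.
move=> y0 xy; rewrite leNgt; apply/negP => yx.
case: y y0 xy yx => [t||] // t0 xy yx; last by rewrite ltNge leey in yx.
by move: yx => /(xy t t0); rewrite ltxx.
Qed.

Section slope.
Context (R : realType) (X : metricType R).
Implicit Types (f : X -> \bar R) (x u : X) (A Y : set X).

Lemma descent_quotient_ge0 f x u : (0 <= descent_quotient f x u)%E.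
Proof.
by rewrite mule_ge0// ?le_max ?lexx ?orbT// lee_fin invr_ge0 mdist_ge0.
Qed.

(** The real level [a] separates [f u] from [f x - t * mdist x u]: the values of
    [f] enter through strict inequalities against real numbers only, and all the
    infinite cases are covered at once. *)
Lemma lt_descent_quotientP f x u (t : R) : 0 <= t -> 0 < mdist x u ->
  (t%:E < descent_quotient f x u)%E <->
  exists2 a : R, (f u < a%:E)%E & ((a + t * mdist x u)%:E < f x)%E.
Proof.
move=> t0 d0; rewrite /descent_quotient lte_pdivlMr// -EFinM lt_max lte_fin.
have -> : (t * mdist x u < 0) = false.
  by apply/negbTE; rewrite -leNgt mulr_ge0// ltW.
rewrite orbF lte_suber_addr//; split.
- move=> /ereal_dense_EFin[c uc cx]; exists (c - t * mdist x u).
    by rewrite EFinB lteBrDl.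
  by rewrite subrK.
- move=> [a ua]; apply: le_lt_trans.
  by rewrite addrC EFinD leeD2r// ltW.
Qed.

Lemma slope_on_ge0 Y f x : Y x -> (0 <= slope_on Y f x)%E.
Proof.
rewrite /slope_on => Yx; case: asboolP => // isoF.
apply: limf_esup_ge0 => [|u]; last exact: descent_quotient_ge0.
have : limit_point Y x.
  have := subset_closure Yx.
  by rewrite closure_isolated_limit_point => -[].
by move=> limx /limx[y [/eqP yx Yy]]; apply.
Qed.

(** A limsup exceeds [t] only if quotients above some fixed bound larger than
    [t] occur arbitrarily close to [x], whence the intermediate [s].  The
    right-hand side is false at isolated points of [Y], in agreement with the
    convention that the slope is [0] there. *)
Lemma lt_slope_onP Y f x (t : R) : Y x -> 0 <= t ->
  (t%:E < slope_on Y f x)%E <->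
  exists2 s : R, t < s & forall r : R, 0 < r ->
    exists u, [/\ Y u, 0 < mdist x u < r & (s%:E < descent_quotient f x u)%E].
Proof.
move=> Yx t0; rewrite /slope_on; case: asboolP => isox.
  split; first by rewrite lte_fin ltNge t0.
  move: isox => [_ [V /nbhs_ballP[r /= r0 rV] VY]] [s _ /(_ r r0)[u []]].
  move=> Yu /andP[d0 dr] _; move: d0; rewrite mdist_gt0 => /eqP; case.
  have : (V `&` Y) u by split=> //; apply: rV; rewrite ballEmdist.
  by rewrite VY.
split.
- move=> /ereal_dense_EFin[s ts sq]; exists s => // r r0.
  have /ereal_sup_gt[_ [u [Yux xur] <-] su] : (s%:E <
      ereal_sup (descent_quotient f x @` ((Y `\ x) `&` ball x r)))%E.
    apply: lt_le_trans sq _; apply: ereal_inf_lbound.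
    exists ((Y `\ x) `&` ball x r) => //.
    by rewrite /within/=; near=> u => Yu; split=> //; near: u; exact: nbhsx_ballx.
  case: Yux => Yu /= ux; exists u; split=> //.
  rewrite mdist_gt0; move: xur; rewrite ballEmdist/= => ->.
  by rewrite andbT; apply/eqP => xu; apply: ux.
- move=> [s ts H]; apply: (@lt_le_trans _ _ s%:E); first by rewrite lte_fin.
  apply: le_ereal_inf_tmp => _ [V VF <-].
  move: VF; rewrite /within/= => /nbhs_ballP[r /= r0 rV].
  have [u [Yu /andP[d0 dr] su]] := H r r0.
  apply: le_trans (ltW su) _; apply: ereal_sup_ubound; exists u => //.
  apply: rV; first by rewrite ballEmdist.
  by split=> //= ux; move: d0; rewrite ux mdistxx ltxx.
Unshelve. all: by end_near. Qed.

(** The inner radius [p] is what makes the property stable under closure: it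
    keeps a witness found from a nearby centre away from the limit point.  The
    set [S] of allowed parameters is [rational] when countability matters and
    [setT] when slopes are computed. *)
Definition annulus_saturated (S : set R) f A :=
  forall (p q a : R) x u, S p -> S q -> S a -> A x ->
    p < mdist x u < q -> (f u < a%:E)%E ->
    exists v, [/\ A v, p < mdist x v < q & (f v < a%:E)%E].

Lemma annulus_saturatedS (S S' : set R) f A : S `<=` S' ->
  annulus_saturated S' f A -> annulus_saturated S f A.
Proof. by move=> SS' satA p q a x u /SS' ? /SS' ? /SS' ?; exact: satA. Qed.

Lemma annulus_saturated_bigcup (S : set R) f (Y_ : nat -> set X) :
  (forall i, annulus_saturated S f (Y_ i)) ->
  annulus_saturated S f (\bigcup_i Y_ i).
Proof.
move=> satY p q a x u Sp Sq Sa [i _ Yx] xu ua.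
have [v [Yv xv va]] := satY i p q a x u Sp Sq Sa Yx xu ua.
by exists v; split=> //; exists i.
Qed.

(** Given [u] in an annulus around [x] in the closure of [A], shrink the annulus
    to rational radii; for [y] in [A] close enough to [x], the point [u] lies in
    the shrunken annulus around [y], and every point of the latter lies in the
    original annulus around [x].  Only distances move, the level stays below
    [a], so [f] may be arbitrarily discontinuous. *)
Lemma annulus_saturated_closure f A :
  annulus_saturated rational f A -> annulus_saturated setT f (closure A).
Proof.
have ratS z : rational (ratr z : R) by exists z.
move=> satA p q a x u _ _ _ clAx /andP[pd dq] ua.
have [b ub ba] := ereal_dense_EFin ua.
have [p' /[!in_itv]/= /andP[pp' p'd]] := rat_in_itvoo pd.
have [q' /[!in_itv]/= /andP[dq' q'q]] := rat_in_itvoo dq.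
have [a' /[!in_itv]/= /andP[ba' a'a]] := rat_in_itvoo (ba : b < a).
(* [e] is below each of the four gaps between the original and the shrunken
   radii and [mdist x u]; this is how far the centre may be moved. *)
pose e := Num.min (Num.min (ratr p' - p) (mdist x u - ratr p'))
                  (Num.min (ratr q' - mdist x u) (q - ratr q')).
have e0 : 0 < e by rewrite !lt_min !subr_gt0 pp' p'd dq' q'q.
have [y [Ay]] := clAx _ (nbhsx_ballx x e e0).
rewrite ballEmdist/= !lt_min => /andP[/andP[xy1 xy2] /andP[xy3 xy4]].
have yx := metric_sym x y.
have yu1 := metric_triangle x y u.
have yu2 := metric_triangle y x u.
have [||v [Av /andP[pv vq] va]] :=
    satA (ratr p') (ratr q') (ratr a') y u (ratS _) (ratS _) (ratS _) Ay.
- by apply/andP; split; lra.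
- by apply: lt_trans ub _; rewrite lte_fin.
have xv1 := metric_triangle x y v.
have xv2 := metric_triangle y x v.
exists v; split; first exact: subset_closure.
- by apply/andP; split; lra.
- by apply: lt_trans va _; rewrite lte_fin.
Qed.

Lemma countable_rational : countable (rational : set R).
Proof. exact: sub_countable (card_image_le _ _) (countableP _). Qed.

(** Each stage consists of one chosen witness for every centre in the previous
    stage and every triple of rational parameters, so stages stay countable, and
    the requirements of a point of the union are met one stage later. *)
Lemma annulus_saturated_hull f D : countable D ->
  exists E : set X, [/\ countable E, D `<=` E & annulus_saturated rational f E].
Proof.
move=> cD.
pose P (z : X * (R * R * R)) v :=
  z.2.1.1 < mdist z.1 v < z.2.1.2 /\ (f v < z.2.2%:E)%E.
have /choice[w wP] z : exists v, (exists u, P z u) -> P z v.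
  by have [[v Pv]|nP] := pselect (exists u, P z u); [exists v|exists z.1].
pose step A := w @` (A `*` (rational `*` rational `*` rational)).
pose E_ n := iter n step D.
exists (\bigcup_n E_ n); split.
- apply: bigcup_countable => // n _; elim: n => //= n IHn.
  apply: sub_countable (card_image_le _ _) _.
  by do ![apply: countableX => //]; exact: countable_rational.
- by move=> x Dx; exists 0%N.
- move=> p q a x u Sp Sq Sa [n _ Ex] xu ua.
  have [xv va] := wP (x, (p, q, a)) (ex_intro _ u (conj xu ua)).
  exists (w (x, (p, q, a))); split=> //; exists n.+1 => //=.
  by exists (x, (p, q, a)).
Qed.

(** If [u] gives a quotient above [s] at [x], saturation replaces [u] by some [v]
    in [Y] with [f v < a] and [mdist x v < q], where [q] is so close to
    [mdist x u] that [a + s * q < f x] still holds; the inner radius [0] ensures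
    [v <> x].  This also handles points isolated in [Y]: their slope in the whole
    space vanishes because a positive one would yield such [v] arbitrarily close. *)
Lemma annulus_saturated_slope f Y x : annulus_saturated setT f Y -> Y x ->
  slope_on Y f x = slope f x.
Proof.
move=> satY Yx; apply/eqP; rewrite eq_le; apply/andP; split.
- apply: le_of_lt_nneg_EFin => [|t t0]; first exact: slope_on_ge0.
  rewrite /slope !lt_slope_onP// => -[s ts H]; exists s => // r /H[u [_ xu su]].
  by exists u.
apply: le_of_lt_nneg_EFin => [|t t0]; first exact: slope_on_ge0.
rewrite /slope !lt_slope_onP// => -[s ts H]; exists s => // r r0.
have s0 : 0 <= s := le_trans t0 (ltW ts).
have [u [_ /andP[d0 dr] /lt_descent_quotientP-/(_ s0 d0)[a ua ax]]] := H r r0.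
have [c ac cx] := ereal_dense_EFin ax.
have [q [dq qr qc]] : exists q, [/\ mdist x u < q, q <= r & a + s * q <= c].
  move: ac; rewrite lte_fin => ac.
  (* [q] exceeds [mdist x u] by at most [e]; dividing by [s + 1] rather than
     [s] keeps [e] positive and well defined for [s = 0]. *)
  pose e := (c - (a + s * mdist x u)) / (s + 1).
  have e0 : 0 < e by rewrite divr_gt0 ?subr_gt0// ltr_wpDl.
  exists (Num.min r (mdist x u + e)); rewrite lt_min dr ltrDl e0 ge_min lexx.
  split=> //.
  have : s * Num.min r (mdist x u + e) <= s * (mdist x u + e).
    by rewrite ler_wpM2l// ge_min lexx orbT.
  have : (s + 1) * e = c - (a + s * mdist x u).
    by rewrite mulrC divfK// gt_eqF// ltr_wpDl.
  by rewrite mulrDr; lra.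
have [|v [Yv /andP[v0 vq] va]] := satY 0 q a x u I I I Yx _ ua.
  by rewrite d0.
exists v; split=> //; first by rewrite v0 (lt_le_trans vq).
apply/lt_descent_quotientP => //; exists a => //.
apply: le_lt_trans cx; rewrite lee_fin; apply: le_trans qc.
by rewrite lerD2l ler_wpM2l// ltW.
Qed.

End slope.

Lemma separable_set_closure (T : topologicalType) (A : set T) :
  separable_set A -> separable_set (closure A).
Proof.
move=> [D [cD DA AD]]; exists D; split=> //.
  by move=> x /DA; exact: subset_closure.
by rewrite [X in _ `<=` X](closure_id _).1//; [exact: closureS|exact: closed_closure].
Qed.

Lemma separable_set_bigcup (T : topologicalType) (A_ : nat -> set T) :
  (forall i, separable_set (A_ i)) -> separable_set (\bigcup_i A_ i).
Proof.
move=> /choice[D_ DP]; exists (\bigcup_i D_ i); split.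
- by apply: bigcup_countable => // i _; case: (DP i).
- by move=> x [i _ Dx]; exists i => //; case: (DP i) => _ + _; apply.
- move=> x [i _ Ax]; have [_ _ /(_ x Ax)] := DP i.
  by apply: closureS => y Dy; exists i.
Qed.

Theorem theorem4p2 (R : realType) (X : metricType R) (f : X -> \bar R)
    (f_gtNy : forall x, f x <> -oo%E)
    (f_proper : exists x, f x <> +oo%E) :
  exists F : set (set X), rich_family F /\
    forall Y : set X, F Y -> forall x : X, Y x ->
      slope f x = slope_on Y f x.
Proof.
exists [set Y | [/\ closed Y, separable_set Y & annulus_saturated setT f Y]].
split; last first.
  by move=> Y [_ _ satY] x Yx; rewrite (annulus_saturated_slope satY).
split.
- by move=> Y [].
- move=> Y0 [D [cD _ Y0D]].
  have [E [cE DE satE]] := annulus_saturated_hull f cD.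
  exists (closure E); last exact: subset_trans Y0D (closureS DE).
  split; [exact: closed_closure| |exact: annulus_saturated_closure].
  by apply: separable_set_closure; exists E; split=> //; exact: subset_closure.
- move=> Y_ FY _; split; first exact: closed_closure.
    by apply/separable_set_closure/separable_set_bigcup => i; case: (FY i).
  apply/annulus_saturated_closure/annulus_saturated_bigcup => i.
  by apply: (@annulus_saturatedS _ _ _ setT) => //; case: (FY i).
Qed.
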